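(* The maximal spectrum $\mathrm{Specm}(\mathrm{Reg}([0,1],\mathbb{R}))$ is totally disconnected and Hausdorff.
   Context: $\mathrm{Reg}([0,1],\mathbb{R})$ is the ring (with pointwise operations) of regulated functions on $[0,1]$: all functions $f:[0,1]\to\mathbb{R}$ such that for every $c\in[0,1)$ the limit $f(c+)=\lim_{x\to c,\,x>c}f(x)$ exists in $\mathbb{R}$ and for every $c\in(0,1]$ the limit $f(c-)=\lim_{x\to c,\,x<c}f(x)$ exists in $\mathbb{R}$. For a commutative ring $R$, $\mathrm{Specm}(R)$ is the set of maximal ideals of $R$ with the subspace topology induced from the Zariski topology on $\mathrm{Spec}(R)$. *)

(* Defs.v *)
From HB Require Import structures.
From mathcomp Require Import all_boot all_order all_algebra.
From mathcomp Require Import all_classical all_reals all_analysis.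

Set Implicit Arguments.
Unset Strict Implicit.
Unset Printing Implicit Defensive.

Import Order.TTheory GRing.Theory Num.Theory.
Import numFieldNormedType.Exports.

Local Open Scope classical_set_scope.
Local Open Scope ring_scope.

(* Ideals are classical subsets of the ring, viewed as boolean predicates
   through [x \in I], so that the ring_quotient predicates apply. Note that
   [idealr_closed] already requires the ideal to be proper (1 \notin I). *)

Definition is_prime_ideal (A : comNzRingType) (P : set A) : Prop :=
  idealr_closed (fun x => x \in P) /\ prime_idealr_closed (fun x => x \in P).

Definition is_maximal_ideal (A : comNzRingType) (M : set A) : Prop :=
  idealr_closed (fun x => x \in M) /\
  forall J : set A, idealr_closed (fun x => x \in J) -> M `<=` J -> J = M.

Section PrimeSpectrum.
Variable A : comNzRingType.

Record Spec : Type := MkSpec {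
  spec_ideal :> set A ;
  spec_prime : is_prime_ideal spec_ideal
}.

HB.instance Definition _ := gen_eqMixin Spec.
HB.instance Definition _ := gen_choiceMixin Spec.

Lemma spec_ideal_inj : injective spec_ideal.
Proof.
by move=> [P hP] [Q hQ] /= PQ; subst Q; congr MkSpec; exact: Prop_irrelevance.
Qed.

(* V(E); the subset E need not be an ideal, as V(E) = V((E)). *)
Definition zariski_zeros (E : set A) : set Spec :=
  [set P : Spec | E `<=` spec_ideal P].

Definition zariski_open (U : set Spec) : Prop :=
  exists E : set A, U = ~` zariski_zeros E.

Lemma zariski_openT : zariski_open setT.
Proof.
exists setT; apply/seteqP; split=> // P _ /= sTP.
have [[_ /negP P1 _] _] := spec_prime P.
by apply: P1; rewrite inE; exact: sTP.
Qed.

Lemma zariski_openI : setI_closed zariski_open.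
Proof.
move=> _ _ [E ->] [F ->]; rewrite -setCU.
exists [set z | exists2 x, E x & exists2 y, F y & z = x * y].
congr (~` _); apply/seteqP; split=> P /=.
- have [[_ _ idP] _] := spec_prime P; have [[P0 _ _] _] := spec_prime P.
  case=> [sEP|sFP] _ [x Ex [y Fy ->]]; apply: set_mem.
  + by rewrite mulrC -[_ * _]addr0; apply: idP P0; rewrite inE; exact: sEP.
  + by rewrite -[_ * _]addr0; apply: idP P0; rewrite inE; exact: sFP.
- move=> sP; have [|/existsNP[x /not_implyP[Ex nPx]]] := pselect (E `<=` P).
    by left.
  have [|/existsNP[y /not_implyP[Fy nPy]]] := pselect (F `<=` P).
    by right.
  have [_ prP] := spec_prime P.
  have /prP/orP[|] : x * y \in spec_ideal P.
    by rewrite inE; apply: sP; exists x => //; exists y.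
  + by rewrite inE.
  + by rewrite inE.
Qed.

Lemma zariski_open_bigU (T : Type) (f : T -> set Spec) :
  (forall i, zariski_open (f i)) -> zariski_open (\bigcup_i f i).
Proof.
move=> /choice[E fE]; exists (\bigcup_i E i).
rewrite -[LHS]setCK setC_bigcup; congr (~` _).
apply/seteqP; split=> P /=.
- move=> h x [i _ Eix]; have := h i I; rewrite fE setCK; exact.
- by move=> h i _; rewrite fE setCK => x Ex; apply: h; exists i.
Qed.

HB.instance Definition _ :=
  isOpenTopological.Build Spec zariski_openT zariski_openI zariski_open_bigU.

(* Maximal ideals are prime (lemma [maximal_ideal_prime] below), so carving
   them out of [Spec] loses none of them. [set_type] carries the subspace
   topology. *)
Definition Specm : Type := set_type [set P : Spec | is_maximal_ideal P].

HB.instance Definition _ := Topological.on Specm.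

End PrimeSpectrum.

Lemma maximal_ideal_prime (A : comNzRingType) (M : set A) :
  is_maximal_ideal M -> is_prime_ideal M.
Proof.
move=> [idM maxM]; split=> // u v; rewrite !inE => Muv.
have [M0 _ idMD] := idM; rewrite !inE in M0.
have MD a x y : M x -> M y -> M (a * x + y).
  by move=> Mx My; apply: set_mem; apply: idMD; rewrite inE.
have [Mu|nMu] := pselect (M u); first by rewrite (mem_set Mu).
apply/orP; right; rewrite inE.
pose J : set A := [set z | exists a, M (z - a * u)].
have MJ : M `<=` J by move=> x Mx; exists 0; rewrite mul0r subr0.
have [J1|nJ1] := pselect (J 1).
  have [a Ma] := J1.
  rewrite -[v](subrK (a * u * v)).
  have -> : v - a * u * v = v * (1 - a * u) + 0.
    by rewrite addr0 mulrBr mulr1 [v * _]mulrC.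
  have -> : v * (1 - a * u) + 0 + a * u * v = a * (u * v) + (v * (1 - a * u) + 0).
    by rewrite addrC mulrA.
  by apply: (MD) => //; exact: (MD).
exfalso; apply: nMu; rewrite -(maxM J) //.
  by exists 1; rewrite mul1r subrr.
split; first by rewrite inE; exact: MJ.
- by apply/negP; rewrite inE.
- move=> a x y; rewrite !inE => -[b Mb] [c Mc]; exists (a * b + c).
  have -> : a * x + y - (a * b + c) * u = a * (x - b * u) + (y - c * u).
    by rewrite mulrDl mulrBr opprD addrACA mulrA.
  exact: MD.
Qed.

Section Regulated.
Variable R : realType.

Definition I01 : Type := set_type (`[0, 1]%classic : set R).

HB.instance Definition _ := Topological.on I01.

Let zero_in_I01 : (0 : R) \in (`[0, 1]%classic : set R).
Proof. by rewrite inE /= in_itv /= lexx ler01. Qed.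

HB.instance Definition _ := isPointed.Build I01 (exist _ 0 zero_in_I01).

(* Filters of the limits x -> c, x > c and x -> c, x < c within [0, 1]. *)
Definition I01_right (c : I01) : set_system I01 :=
  within [set x : I01 | set_val c < set_val x] (nbhs c).

Definition I01_left (c : I01) : set_system I01 :=
  within [set x : I01 | set_val x < set_val c] (nbhs c).

Definition is_regulated (f : I01 -> R) : Prop :=
  (forall c : I01, set_val c < 1 ->
     exists l : R, f x @[x --> I01_right c] --> l) /\
  (forall c : I01, 0 < set_val c ->
     exists l : R, f x @[x --> I01_left c] --> l).

Definition regulated : {pred I01 -> R} := fun f => `[< is_regulated f >].

Lemma regulated_subring_closed : subring_closed regulated.
Proof.
split.
- by apply/asboolP; split=> c _; exists 1; exact: cvg_cst.
- move=> f g /asboolP[fr fl] /asboolP[gr gl]; apply/asboolP; split=> c hc.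
  + have [[l fl'] [m gm]] := (fr c hc, gr c hc).
    by exists (l - m); exact: cvgB.
  + have [[l fl'] [m gm]] := (fl c hc, gl c hc).
    by exists (l - m); exact: cvgB.
- move=> f g /asboolP[fr fl] /asboolP[gr gl]; apply/asboolP; split=> c hc.
  + have [[l fl'] [m gm]] := (fr c hc, gr c hc).
    by exists (l * m); exact: cvgM.
  + have [[l fl'] [m gm]] := (fl c hc, gl c hc).
    by exists (l * m); exact: cvgM.
Qed.

HB.instance Definition _ :=
  GRing.isSubringClosed.Build (I01 -> R) regulated regulated_subring_closed.

Record Reg : Type := MkReg {
  reg_fun :> I01 -> R ;
  reg_funP : reg_fun \in regulated
}.

HB.instance Definition _ := [isSub for reg_fun].
HB.instance Definition _ := [Choice of Reg by <:].
HB.instance Definition _ := [SubChoice_isSubComNzRing of Reg by <:].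

End Regulated.

(* Main.v *)
Require Import Defs.
From mathcomp Require Import all_boot all_order all_algebra.
From mathcomp Require Import all_classical all_reals all_analysis.
From mathcomp Require Import ring lra.

(** The ring of regulated functions has so many idempotents, namely the
    indicators of finite unions of intervals, that any two maximal ideals are
    told apart by one of them; and an idempotent cuts the spectrum into two
    clopen pieces.

    On the algebraic side, distinct maximal ideals [M] and [N] are comaximal,
    so some [f] lies in one while [1 - f] lies in the other. If the ring has
    the exchange property, there is an idempotent [e] with [e] a multiple of
    [f] and [1 - e] a multiple of [1 - f]; then [e] lies in one of [M], [N]
    and [1 - e] in the other. As a prime ideal contains exactly one of [e]
    and [1 - e], the primes containing [e] form a clopen set. Hence the
    maximal spectrum is zero-dimensional
    ([exchange_ring_Specm_zero_dimensional]), which gives both total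
    disconnectedness and separation.

    On the analytic side, given a regulated [f], an indicator [e] is sought
    such that [f >= 1/4] where [e = 1] and [1 - f >= 1/4] where [e = 0]: then
    [e / f] and [(1 - e) / (1 - f)] make sense and are regulated
    ([idempotent_multiple]), which is the exchange property. The set
    [f >= 1/2] need not have a regulated indicator, since [f] may oscillate
    around [1/2]; but the overlap between [f >= 1/4] and [f <= 3/4] leaves
    room to choose. Near each point the existence of one-sided limits permits
    an [e] that is constant on either side of the point
    ([locally_separates]), and a supremum argument on [0, 1] glues these
    local choices ([globally_separates]). *)

Import Order.TTheory GRing.Theory Num.Theory.
Import numFieldNormedType.Exports.

Local Open Scope classical_set_scope.
Local Open Scope ring_scope.

(** * Idempotents and the maximal spectrum *)

Lemma zero_dimensional_hausdorff (T : topologicalType) :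
  zero_dimensional T -> hausdorff_space T.
Proof.
move=> zdT; rewrite open_hausdorff => x y /zdT[U [[oU cU] Ux nUy]].
exists (U, ~` U); first by split; rewrite inE.
by split=> //=; [exact: closed_openC | rewrite setICr].
Qed.

(** Nicholson's element-wise characterization of exchange rings, for
    commutative rings. *)
Definition exchange_ring (A : comNzRingType) : Prop :=
  forall f : A, exists e, [/\ e * e = e,
    exists g, e = f * g & exists h, 1 - e = (1 - f) * h].

Section MaximalIdeals.
Variable A : comNzRingType.
Implicit Types M N : set A.

(** Otherwise [M + N] would be a proper ideal containing both [M] and [N],
    hence equal to each of them. *)
Lemma maximal_ideals_comaximal M N :
  is_maximal_ideal M -> is_maximal_ideal N -> M <> N ->
  exists f : A, N f /\ M (1 - f).
Proof.
move=> [idM maxM] [idN maxN] MN; apply: contrapT => nex.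
have [M0 _ MD] := idM; have [N0 _ ND] := idN.
pose J : set A := [set z | exists2 x, N x & M (z - x)].
have MJ : M `<=` J by move=> x Mx; exists 0; [exact: set_mem|rewrite subr0].
have NJ : N `<=` J.
  by move=> x Nx; exists x => //; rewrite subrr; exact: set_mem.
have idJ : idealr_closed (fun x => x \in J).
  split; first by rewrite inE; exact: MJ (set_mem M0).
  - by apply/negP; rewrite inE => -[f Nf Mf]; apply: nex; exists f.
  - move=> a x y; rewrite !inE => -[u Nu Mu] [v Nv Mv]; exists (a * u + v).
      by apply: set_mem; apply: ND; rewrite inE.
    have -> : a * x + y - (a * u + v) = a * (x - u) + (y - v) by ring.
    by apply: set_mem; apply: MD; rewrite inE.
by apply: MN; rewrite -(maxM J idJ MJ) (maxN J idJ NJ).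
Qed.

Lemma ideal_mulr (P : Spec A) (x y : A) : spec_ideal P x -> spec_ideal P (x * y).
Proof.
move=> Px; have [[P0 _ PD] _] := spec_prime P.
by rewrite mulrC -[_ * _]addr0; apply: set_mem; apply: PD => //; rewrite inE.
Qed.

(** Not both, as their sum is [1]; at least one, as their product is [0]. *)
Lemma prime_idempotent (P : Spec A) (e : A) : e * e = e ->
  spec_ideal P (1 - e) <-> ~ spec_ideal P e.
Proof.
move=> ee; have [[P0 /negP P1 PD] prP] := spec_prime P; split.
  move=> PNe Pe; apply: P1.
  have -> : 1 = 1 * (1 - e) + e by rewrite mul1r subrK.
  by apply: PD; rewrite inE.
move=> nPe; have : e * (1 - e) \in spec_ideal P.
  by rewrite mulrBr mulr1 ee subrr.
by case/prP/orP; rewrite !inE.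
Qed.

Lemma clopen_idempotent (e : A) : e * e = e ->
  clopen [set P : Spec A | spec_ideal P e].
Proof.
move=> ee; split.
  exists [set 1 - e]; apply/seteqP; split=> P /=.
    move=> Pe sP; have /(prime_idempotent P _ ee) : spec_ideal P (1 - e) by exact: sP.
    exact.
  move=> nP; apply: contrapT => /(prime_idempotent P _ ee) PNe; apply: nP.
  by move=> _ ->.
rewrite -openC; exists [set e]; apply/seteqP; split=> P /= nP.
  by move=> sP; apply: nP; exact: sP.
by move=> Pe; apply: nP => _ ->.
Qed.

(** The clopen set that separates [M] from [N] is cut out by the idempotent
    attached to an [f] in [M] with [1 - f] in [N]. *)
Lemma exchange_ring_Specm_zero_dimensional :
  exchange_ring A -> zero_dimensional (Specm A).
Proof.
move=> exA M N /eqP MN.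
have maxM := set_valP M; have maxN := set_valP N.
have [|f [Mf NNf]] := maximal_ideals_comaximal _ _ maxN maxM.
  by move=> NM; apply: MN; apply/val_inj/spec_ideal_inj.
have [e [ee [g eg] [h eh]]] := exA f.
exists (set_val @^-1` [set P : Spec A | spec_ideal P e]); split.
- by apply: preimage_clopen; [exact: clopen_idempotent|exact: initial_continuous].
- by rewrite /= eg; exact: ideal_mulr.
- apply/(prime_idempotent _ _ ee).
  by rewrite eh; exact: ideal_mulr.
Qed.

End MaximalIdeals.

(** * Regulated functions with values 0 and 1 *)

Section Regulated.
Variable R : realType.
Implicit Types (f e : Reg R) (x c : I01 R).

Lemma regulatedP (f : I01 R -> R) : is_regulated f -> f \in regulated (R:=R).
Proof. by move=> rf; apply/asboolP. Qed.

Lemma reg_is_regulated f : is_regulated f.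
Proof. exact/asboolP/(reg_funP f). Qed.

Lemma regP f e : (forall x, f x = e x) -> f = e.
Proof. by move=> fe; apply: val_inj; apply/funext. Qed.

Lemma regE x :
  (prod (prod (forall f e, (f + e) x = f x + e x)
              (forall f, (- f) x = - f x))
        (forall f e, (f * e) x = f x * e x)) *
  (((0 : Reg R) x = 0) * ((1 : Reg R) x = 1)).
Proof. by []. Qed.

Lemma idempotent_reg_values e x : e * e = e -> e x = 0 \/ e x = 1.
Proof.
move=> /(congr1 (fun u : Reg R => u x)) /= eex.
have /eqP : e x * (e x - 1) = 0 by rewrite mulrBr mulr1 [X in X - _]eex subrr.
by rewrite mulf_eq0 subr_eq0 => /orP[] /eqP; [left|right].
Qed.

Lemma I01_itv x : 0 <= set_val x <= 1.
Proof. by have := set_valP x; rewrite /= in_itv. Qed.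

Lemma nbhs_I01 c (U : set (I01 R)) : nbhs c U ->
  exists2 d : R, 0 < d &
    forall x, `|set_val x - set_val c| < d -> U x.
Proof.
move=> [_ [[V oV <-] /= Vc VU]].
have /nbhs_ballP[d d0 dV] := open_nbhs_nbhs (conj oV Vc).
by exists d => // x xc; apply: VU; apply: dV; rewrite /ball /= distrC.
Qed.

Lemma near_I01 c (d : R) : 0 < d ->
  \forall x \near c, `|set_val x - set_val c| < d.
Proof.
move=> d0; have /cvgrPdist_lt/(_ d d0) := @initial_continuous _ _ set_val c.
by apply: filterS => x; rewrite distrC.
Qed.

(** Both indicators, of [x < t] and of [x <= t], are needed to isolate the
    point [t]; the boolean [b] selects the second. The indicator is eventually
    constant on each side of every point [c]: on the side facing away from [t]
    this holds outright, on the other one it holds up to [t]. *)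
Lemma regulated_lteif (b : bool) (t : R) :
  is_regulated (fun x : I01 R => (set_val x < t ?<= if b)%:R).
Proof.
split=> c _; rewrite /I01_right /I01_left.
- have [tc|ct] := leP t (set_val c).
    exists 0; apply: cvg_near_cst; rewrite near_withinE; apply: filterE => x /= cx.
    by rewrite lteifNF ?lteifS //; exact: le_lt_trans cx.
  exists 1; apply: cvg_near_cst; rewrite near_withinE.
  have := @near_I01 c (t - set_val c); rewrite subr_gt0 => /(_ ct).
  apply: filterS => x xc _; move: xc => /ltr_distlDr; rewrite subrKC => xt.
  by rewrite lteifS.
- have [ct|tc] := leP (set_val c) t.
    exists 1; apply: cvg_near_cst; rewrite near_withinE; apply: filterE => x /= xc.
    by rewrite lteifS //; exact: lt_le_trans ct.
  exists 0; apply: cvg_near_cst; rewrite near_withinE.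
  have := @near_I01 c (set_val c - t); rewrite subr_gt0 => /(_ tc).
  apply: filterS => x xc _; move: xc => /ltr_distlCBl; rewrite subKr => tx.
  by rewrite lteifNF // lteifS.
Qed.

Definition initial_indic (b : bool) (t : R) : Reg R :=
  MkReg (regulatedP _ (regulated_lteif b t)).

Lemma initial_indic1 b t x :
  initial_indic b t x = 1 -> set_val x < t ?<= if b.
Proof. by rewrite /=; case: (_ < _ ?<= if _) => // /eqP; rewrite eq_sym oner_eq0. Qed.

Lemma initial_indic0 b t x :
  initial_indic b t x = 0 -> t < set_val x ?<= if ~~ b.
Proof. by rewrite /= lteifNE; case: (_ < _ ?<= if _) => // /eqP; rewrite oner_eq0. Qed.

(** * Division by a regulated function bounded below *)

(** Truncating at [1/4] keeps the denominator, and its one-sided limits, away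
    from [0], so that the inverse is regulated whatever [f] is; where
    [f >= 1/4] it is the inverse of [f]. *)
Definition truncated_inv (f : Reg R) (x : I01 R) : R :=
  (Num.max (f x) 4^-1)^-1.

Lemma regulated_truncated_inv f : is_regulated (truncated_inv f).
Proof.
have cvg_trunc (F : set_system (I01 R)) (l : R) : Filter F -> f @ F --> l ->
    exists m : R, truncated_inv f @ F --> m.
  move=> FF fl; exists (Num.max l 4^-1)^-1; apply: cvgV.
    by rewrite gt_eqF // lt_max invr_gt0 ltr0n orbT.
  apply: (@continuous_cvg _ _ _ F _ f (fun u => Num.max u 4^-1)) => //.
  by apply: continuous_max; [exact: cvg_id|exact: cvg_cst].
have [fr fl] := reg_is_regulated f.
split=> c hc; [have [l] := fr c hc|have [l] := fl c hc]; exact: cvg_trunc.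
Qed.

(** The cofactor is [e / f], read as [0] where [e] vanishes. *)
Lemma idempotent_multiple f e : e * e = e ->
  (forall x, e x = 1 -> 4^-1 <= f x) -> exists g, e = f * g.
Proof.
move=> ee fe; exists (e * MkReg (regulatedP _ (regulated_truncated_inv f))).
apply: regP => x; rewrite !regE /= /truncated_inv.
have [->|e1] := idempotent_reg_values _ x ee; first by rewrite mul0r mulr0.
have f4 := fe x e1; rewrite e1 mul1r max_l // divff // gt_eqF //.
by apply: lt_le_trans f4; rewrite invr_gt0 ltr0n.
Qed.

(** * Separating the large values of a regulated function from the small *)

Definition separates f e x : Prop :=
  (e x = 1 -> 4^-1 <= f x) /\ (e x = 0 -> 4^-1 <= 1 - f x).

Definition splice (s e1 e2 : Reg R) : Reg R := s * e1 + (1 - s) * e2.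

Lemma splice_idempotent (s e1 e2 : Reg R) :
  s * s = s -> e1 * e1 = e1 -> e2 * e2 = e2 ->
  splice s e1 e2 * splice s e1 e2 = splice s e1 e2.
Proof.
move=> ss e11 e22; rewrite /splice.
transitivity (s * s * (e1 * e1) + (s - s * s) * (2 * e1 * e2)
  + (1 - s - s + s * s) * (e2 * e2)); first by ring.
by rewrite ss e11 e22 subrr mul0r addr0 subrK.
Qed.

Lemma splice_separates f (s e1 e2 : Reg R) x : s * s = s ->
  (s x = 1 -> separates f e1 x) -> (s x = 0 -> separates f e2 x) ->
  separates f (splice s e1 e2) x.
Proof.
move=> ss h1 h2; rewrite /separates /splice !regE.
have [s0|s1] := idempotent_reg_values _ x ss.
- by rewrite s0 mul0r add0r subr0 mul1r; exact: h2.
- by rewrite s1 subrr mul0r addr0 mul1r; exact: h1.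
Qed.

Lemma initial_indic_idempotent b t :
  initial_indic b t * initial_indic b t = initial_indic b t.
Proof.
by apply: regP => x; rewrite regE /=; case: (_ < _ ?<= if _); rewrite ?mulr1 ?mulr0.
Qed.

(** Close to the limit [l] the values of [f] are within [1/4] of it, so the
    side of [1/2] on which [l] lies decides between the constants [1] and
    [0]. *)
Lemma constant_separates f (F : set_system (I01 R)) (l : R) : Filter F ->
  f @ F --> l ->
  exists2 e, e * e = e & \forall x \near F, separates f e x.
Proof.
move=> FF /cvgrPdist_lt/(_ 4^-1); rewrite invr_gt0 ltr0n => /(_ isT) fl.
have [l2|l2] := leP 2^-1 l.
- exists 1; first by rewrite mulr1.
  apply: filterS fl => x; rewrite ltr_distl => /andP[lf fl].
  split; rewrite regE; first by lra.
  by move/eqP; rewrite oner_eq0.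
- exists 0; first by rewrite mulr0.
  apply: filterS fl => x; rewrite ltr_distl => /andP[lf fl].
  split; rewrite !regE; last by lra.
  by move/eqP; rewrite eq_sym oner_eq0.
Qed.

Lemma point_separates f c : exists2 e, e * e = e & separates f e c.
Proof.
have fc : f @ globally [set c] --> f c by apply: cvg_near_cst => _ ->.
by have [e ee fe] := constant_separates _ _ _ _ fc; exists e => //; exact: fe.
Qed.

(** At the right endpoint there is nothing on the right, and no limit to
    appeal to; the condition is vacuous there. *)
Lemma right_separates f c :
  exists2 e, e * e = e & \forall x \near I01_right c, separates f e x.
Proof.
have [c1|c1] := ltP (set_val c) 1.
  by have [l /constant_separates] := (reg_is_regulated f).1 c c1; apply.
exists 0; first by rewrite mulr0.
rewrite /I01_right /I01_left near_withinE; apply: filterE => x /= cx.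
by have /andP[_ /(lt_le_trans cx)] := I01_itv x; rewrite ltNge c1.
Qed.

Lemma left_separates f c :
  exists2 e, e * e = e & \forall x \near I01_left c, separates f e x.
Proof.
have [c0|c0] := ltP 0 (set_val c).
  by have [l /constant_separates] := (reg_is_regulated f).2 c c0; apply.
exists 0; first by rewrite mulr0.
rewrite /I01_right /I01_left near_withinE; apply: filterE => x /= xc.
by have /andP[/le_lt_trans/(_ xc)] := I01_itv x; rewrite ltNge c0.
Qed.

(** The constants found on the left of [c], at [c] and on the right of [c] are
    spliced along the indicators of [x < c] and [x <= c]. *)
Lemma locally_separates f c :
  exists2 e, e * e = e & \forall x \near c, separates f e x.
Proof.
have [el eel fl] := left_separates f c.
have [ec eec fc] := point_separates f c.
have [er eer fr] := right_separates f c.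
exists (splice (initial_indic false (set_val c)) el
         (splice (initial_indic true (set_val c)) ec er)).
  by do ![exact: initial_indic_idempotent | apply: splice_idempotent].
move: fl fr; rewrite /I01_left /I01_right !near_withinE.
apply: filterS2 => x fl fr.
apply: splice_separates => [|/initial_indic1 xc|/initial_indic0 /= cx].
- exact: initial_indic_idempotent.
- exact: fl.
apply: splice_separates => [|/initial_indic1 /= xc|/initial_indic0 /= xc].
- exact: initial_indic_idempotent.
- have -> // : x = c by apply: val_inj; apply/le_anti/andP.
- exact: fr.
Qed.

(** Let [S] be the set of the [t <= 1] such that [f] is separated on [0, t] by
    some idempotent. Around [sup S] the local solution continues a solution on
    [0, t], for some [t] in [S] close to [sup S], beyond [sup S]; so the
    supremum must be [1] and the continuation covers [0, 1]. *)
Lemma globally_separates f :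
  exists2 e, e * e = e & forall x, separates f e x.
Proof.
pose S : set R := [set t | t <= 1 /\
  exists2 e, e * e = e & forall x, set_val x <= t -> separates f e x].
have S0 : S 0.
  split; first exact: ler01.
  have [e ee fe] := point_separates f point; exists e => // x x0.
  have -> // : x = point.
  apply: val_inj; apply/le_anti; rewrite [_ <= _]x0 /=.
  by case/andP: (I01_itv x).
have ubS : ubound S 1 by move=> t [].
have supS : has_sup S by split; [exists 0|exists 1].
have s01 : sup S \in `[0, 1]%classic.
  by rewrite inE /= in_itv /= ge_sup ?andbT //; [exact: sup_upper_bound|exists 0].
have [c cE] : exists c : I01 R, set_val c = sup S.
  by exists (exist _ (sup S) s01).
have [e1 ee1 /nbhs_I01[d d0 fe1]] := locally_separates f c.
have [t [t1 [e0 ee0 fe0]] st] := sup_adherent d0 supS.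
(* [u] exceeds [sup S], except when it is [1], and stays within the reach [d]
   of the local solution. *)
pose u := Num.min 1 (sup S + d / 2).
have [e ee fe] : exists2 e, e * e = e &
    forall x, set_val x <= u -> separates f e x.
  exists (splice (initial_indic true t) e0 e1).
    by apply: splice_idempotent => //; exact: initial_indic_idempotent.
  move=> x; rewrite le_min => /andP[_ xu].
  apply: splice_separates => [|/initial_indic1 /= xt|/initial_indic0 /= tx].
  - exact: initial_indic_idempotent.
  - exact: fe0.
  - apply: fe1; rewrite cE ltr_distl.
    rewrite (lt_trans st tx) (le_lt_trans xu) // ltrD2l.
    by rewrite ltr_pdivrMr ?ltr0n // ltr_pMr // ltr1n.
have Su : S u by split; [rewrite ge_min lexx|exists e].
exists e => // x; apply: fe; rewrite le_min; apply/andP; split.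
  by case/andP: (I01_itv x).
have /andP[_ x1] := I01_itv x.
by have := sup_upper_bound supS Su; rewrite ge_min => /orP[|]; lra.
Qed.

(** * The maximal spectrum of the ring of regulated functions *)

Lemma exchange_ring_Reg : exchange_ring (Reg R).
Proof.
move=> f; have [e ee fe] := globally_separates f; exists e; split => //.
  by apply: idempotent_multiple => // x; exact: (fe x).1.
apply: idempotent_multiple.
  by rewrite mulrBl mul1r mulrBr mulr1 ee subrr subr0.
move=> x; rewrite !regE => ex; apply: (fe x).2; lra.
Qed.

End Regulated.

Local Close Scope ring_scope.

Theorem theorem2p7 (R : realType) :
  totally_disconnected [set: Specm (Reg R)] /\
  hausdorff_space (Specm (Reg R)).
Proof.
have zd := exchange_ring_Specm_zero_dimensional _ (exchange_ring_Reg R).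
split; first exact: zero_dimension_totally_disconnected.
exact: zero_dimensional_hausdorff.
Qed.
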